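(* Let $d\ge1$, let $Z\subseteq\mathbb{R}^d$, and assume that the set $N$ of nondominated points of $Z$ is finite and nonempty. Identify $\mathbb{R}^d$ with $\{z\in\mathbb{R}^{d+1} : z_0=0\}$. Then $N$ agrees with the set of those extremal generators of the $\max$-tropical cone $\overline{M}(N)$ which have only finite coordinates (normalized to have $0$th coordinate $0$). Moreover, if $A$ is the set of extremal generators of the complementary $\min$-tropical cone $\overline{W}(N)$ with finite $0$th coordinate, normalized such that this coordinate is $0$, then the set \[ \bigcup_{a\in A}\bigl(a-\mathbb{R}_{>0}^d\bigr),\qquad\text{where } a-\mathbb{R}_{>0}^d:=\{x\in\mathbb{R}^d : x_j<a_j \text{ for all } j\in\operatorname{supp}(a)\setminus\{0\}\}, \] agrees with the complement of $M(N)$ in $\mathbb{R}^d$, i.e. with $\mathbb{R}^d\setminus M(N)$.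
   Context: A point $z\in Z\subseteq\mathbb{R}^d$ is nondominated if there is no $w\in Z$ with $w_i\le z_i$ for all $i\in\{1,\dots,d\}$ and $w_\ell<z_\ell$ for at least one $\ell$. $\mathbb{T}_{\min}=\mathbb{R}\cup\{\infty\}$ with tropical addition $\min$ and tropical multiplication $+$; $\mathbb{T}_{\max}=\mathbb{R}\cup\{-\infty\}$ with $\max$ and $+$. Both carry the order topology, and powers carry the product topology. Coordinates in $\mathbb{T}_{\min}^{d+1}$, $\mathbb{T}_{\max}^{d+1}$ are indexed by $0,1,\dots,d$. $\operatorname{supp}(a)$ is the set of indices $i$ with $a_i\neq\infty$ (if $a\in\mathbb{T}_{\min}^{d+1}$), respectively $a_i\neq-\infty$ (if $a\in\mathbb{T}_{\max}^{d+1}$). A $\min$-tropical cone is a nonempty subset $C\subseteq\mathbb{T}_{\min}^{d+1}$ such that for all $x,y\in C$ and $\lambda,\mu\in\mathbb{T}_{\min}$ the vector $(\min(\lambda+x_i,\mu+y_i))_{i}$ lies in $C$; $\max$-tropical cones are defined likewise with $\max$ and $\mathbb{T}_{\max}$. A set generates $C$ if $C$ is the smallest tropical cone containing it. A finitely generated tropical cone has an inclusion-minimal generating set, unique up to tropical scaling (adding real multiples of the all-ones vector to generators); its elements are the extremal generators. For a finite set $G\subset\mathbb{T}_{\max}^{d+1}$ with $0\in\operatorname{supp}(g)$ for all $g\in G$, define \[ \overline{M}(G)=\bigcup_{g\in G}\{x\in\mathbb{T}_{\max}^{d+1} : x_0-g_0\le\min(x_j-g_j\mid j\in\operatorname{supp}(g)\setminus\{0\})\},\qquad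 M(G)=\overline{M}(G)\cap\mathbb{R}^{d+1}. \] $W(G)$ denotes the closure in $\mathbb{R}^{d+1}$ of $\mathbb{R}^{d+1}\setminus M(G)$, and $\overline{W}(G)$ denotes the closure of $W(G)$ in $\mathbb{T}_{\min}^{d+1}$. Both $\overline{M}(N)$ and $\overline{W}(N)$ are finitely generated tropical cones. *)

(* Defs.v *)
From HB Require Import structures.
From mathcomp Require Export all_boot all_order all_algebra.
From mathcomp Require Export all_classical all_reals all_analysis.

Set Implicit Arguments.
Unset Strict Implicit.
Unset Printing Implicit Defensive.

Import Order.TTheory GRing.Theory Num.Theory.
Import numFieldNormedType.Exports.

Local Open Scope classical_set_scope.
Local Open Scope ring_scope.

Definition nondominated (R : realType) (d : nat) (Z : set 'rV[R]_d) :
    set 'rV[R]_d :=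
  [set z | Z z /\ ~ exists w : 'rV[R]_d,
     [/\ Z w, forall i, w 0 i <= z 0 i & exists l, w 0 l < z 0 l]].

(* The tropical semirings are realized inside \bar R: tropical multiplication
   is the addition of \bar R (the ambiguous sum of +oo and -oo never occurs in
   Tmin or in Tmax), and their order topology is the subspace topology. *)
Definition Tmin (R : realType) : set (\bar R) := [set t | t != -oo%E].
Definition Tmax (R : realType) : set (\bar R) := [set t | t != +oo%E].

Definition vecs_in (R : realType) (T : set (\bar R)) (n : nat) :
    set 'rV[\bar R]_n :=
  [set x | forall i, T (x 0 i)].
Arguments vecs_in {R} T {n}.

(* On vectors over Tmin (resp. Tmax), the finite coordinates are those distinct
   from +oo (resp. -oo). *)
Definition supp (R : realType) (n : nat) (a : 'rV[\bar R]_n) : pred 'I_n :=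
  [pred i | a 0 i \is a fin_num].

Section TropicalCones.
Variables (R : realType) (T : set (\bar R)) (oplus : \bar R -> \bar R -> \bar R).
Variable n : nat.
Implicit Types C G E : set 'rV[\bar R]_n.

Definition tropical_cone C : Prop :=
  [/\ C `<=` vecs_in T,
      C !=set0 &
      forall (x y : 'rV[\bar R]_n) (l m : \bar R), C x -> C y -> T l -> T m ->
        C (\row_i oplus (l + x 0%R i)%E (m + y 0%R i)%E)].

Definition generates G C : Prop :=
  [/\ tropical_cone C,
      G `<=` C &
      forall C', tropical_cone C' -> G `<=` C' -> C `<=` C'].

Definition minimal_generating_set E C : Prop :=
  generates E C /\ forall E', E' `<=` E -> generates E' C -> E' = E.

(* Since a minimal generating set is only unique up to tropical scaling, this
   set contains all the scalings of each extremal generator. *)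
Definition extremal_generators C : set 'rV[\bar R]_n :=
  [set g | exists2 E, minimal_generating_set E C & E g].

End TropicalCones.

Definition min_extremal_generators (R : realType) (n : nat) :=
  @extremal_generators R (@Tmin R) (fun s t => mine s t) n.
Definition max_extremal_generators (R : realType) (n : nat) :=
  @extremal_generators R (@Tmax R) (fun s t => maxe s t) n.

(* Tropical scaling making coordinate 0 equal to 0; meaningful only when that
   coordinate is finite. *)
Definition normalize (R : realType) (d : nat) (g : 'rV[\bar R]_d.+1) :
    'rV[\bar R]_d.+1 :=
  \row_i (g 0%R i - g 0%R ord0)%E.

Definition homog (R : realType) (d : nat) (z : 'rV[R]_d) : 'rV[R]_d.+1 :=
  row_mx (0 : 'rV[R]_1) z.

Definition to_ereal (R : realType) (n : nat) (x : 'rV[R]_n) : 'rV[\bar R]_n :=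
  map_mx (@EFin R) x.

Section ComplementaryCones.
Variables (R : realType) (d : nat) (G : set 'rV[\bar R]_d.+1).

(* The minimum over the empty set is +oo. *)
Definition Mbar : set 'rV[\bar R]_d.+1 :=
  \bigcup_(g in G)
    [set x | vecs_in (@Tmax R) x /\
       (x 0%R ord0 - g 0%R ord0 <=
          \big[mine/+oo]_(j | (j \in supp g) && (j != ord0))
             (x 0%R j - g 0%R j))%E].

Definition M : set 'rV[R]_d.+1 := [set x | Mbar (to_ereal x)].

Definition W : set 'rV[R]_d.+1 := closure (~` M).

(* Closure in the subspace of vectors over Tmin. *)
Definition Wbar : set 'rV[\bar R]_d.+1 :=
  closure (@to_ereal R d.+1 @` W) `&` vecs_in (@Tmin R).

End ComplementaryCones.

Definition open_orthant (R : realType) (d : nat) (a : 'rV[\bar R]_d.+1) :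
    set 'rV[R]_d :=
  [set x | forall j : 'I_d.+1, j \in supp a -> j != ord0 ->
     ((homog x 0%R j)%:E < a 0%R j)%E].

(* Main.v *)
Require Import Defs.

(** In a finitely generated tropical cone the extremal generators are, up to
    scaling, the irreducible vectors: if removing the ray of [e] leaves a cone,
    every generating set meets that ray. Both cones are generated by the tropical
    unit vectors [e_1], ..., [e_d] and a set [V] of vectors with 0th coordinate
    [0] that are extreme among all such vectors of the cone, hence
    irreducible. For [Mbar] the set [V] is [N], because [N] is an antichain. The
    closure [Wbar] consists of the [x] such that every [z] in [N] has some
    [j >= 1] with [x_j <= x_0 + z_j], and [V] is its set of maximal vectors with
    [x_0 = 0]. Recording for each [z] such an index [j] bounds [x] above by one
    of finitely many vectors of [Wbar], so every [x] lies below a maximal one,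
    and the open orthants below these exhaust the complement of [M]. *)

Set Implicit Arguments.
Unset Strict Implicit.
Unset Printing Implicit Defensive.

Import Order.TTheory GRing.Theory Num.Theory.
Import numFieldNormedType.Exports.

Local Open Scope classical_set_scope.
Local Open Scope ring_scope.

(* Common interface to (max, -oo) on [Tmax] and (min, +oo) on [Tmin], so that
   both kinds of cones are treated at once. *)
Record tropical_dioid (R : realType) (T : set (\bar R))
    (op : \bar R -> \bar R -> \bar R) (o : \bar R) : Prop := TropicalDioid {
  dioid_zero : T o;
  dioid_fin : forall r : R, T r%:E;
  dioid_zero_nfin : o \isn't a fin_num;
  dioid_addC : commutative op;
  dioid_add0 : right_id o op;
  dioid_selective : forall a b, op a b = a \/ op a b = b;
  dioid_absorb : forall t, T t -> (t + o = o)%E;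
  dioid_addD : forall (r : R) a b,
    (r%:E + op a b = op (r%:E + a) (r%:E + b))%E }.

Lemma max_dioid (R : realType) :
  tropical_dioid (@Tmax R) (fun s t => maxe s t) -oo%E.
Proof.
split=> //.
- by move=> a b; rewrite maxC.
- exact: maxeNy.
- by move=> a b /=; rewrite maxEle; case: ifP; [right|left].
- by move=> [r||].
- by move=> r a b; rewrite adde_maxr.
Qed.

Lemma min_dioid (R : realType) :
  tropical_dioid (@Tmin R) (fun s t => mine s t) +oo%E.
Proof.
split=> //.
- by move=> a b; rewrite minC.
- exact: miney.
- by move=> a b /=; rewrite minEle; case: ifP; [left|right].
- by move=> [r||].
- by move=> r a b; rewrite /Order.min lteD2lE //; case: ifP.
Qed.

(** * Cones and rays over either semiring *)

Section Tropical.
Variables (R : realType) (T : set (\bar R)) (op : \bar R -> \bar R -> \bar R).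
Variables (o : \bar R) (n : nat).
Hypothesis dioid : tropical_dioid T op o.
Implicit Types (C E V : set 'rV[\bar R]_n.+1) (x y e v : 'rV[\bar R]_n.+1).

Let opC := dioid_addC dioid.
Let op0 := dioid_add0 dioid.
Let sel := dioid_selective dioid.
Let absorb := dioid_absorb dioid.

Lemma dioid_add0l : left_id o op.
Proof. by move=> a; rewrite opC op0. Qed.

Lemma dioid_idem : idempotent_op op.
Proof. by move=> a; case: (sel a a). Qed.

Lemma dioid_add_addl a b : op a (op a b) = op a b.
Proof. by case: (sel a b) => /[dup] ab ->; rewrite ?ab ?dioid_idem. Qed.

Lemma dioid_add_eq0 a b : op a b = o -> a = o.
Proof.
by case: (sel a b) => [->//|/[dup] ab ->] bo; move: ab; rewrite bo op0.
Qed.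

(** Cones are only required to be nonempty; scaling any member by [o] yields the zero vector. *)
Lemma tropical_cone_zero C : tropical_cone T op C -> C (const_mx o).
Proof.
case=> CT [x Cx] Cc; have To := dioid_zero dioid.
have := Cc x x o o Cx Cx To To; congr (C _); apply/rowP => i; rewrite !mxE.
by rewrite addeC absorb ?op0//; exact: CT.
Qed.

Definition tropical_shift (r : R) x : 'rV[\bar R]_n.+1 :=
  \row_i (r%:E + x 0%R i)%E.

Definition ray e : set 'rV[\bar R]_n.+1 :=
  [set x | exists r : R, x = tropical_shift r e].

Lemma rayxx e : ray e e.
Proof. by exists 0; apply/rowP => i; rewrite mxE add0e. Qed.

Lemma tropical_shiftK r x : tropical_shift (- r) (tropical_shift r x) = x.
Proof. by apply/rowP => i; rewrite !mxE addeA -EFinD addNr add0e. Qed.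

Lemma ray_sym e x : ray e x -> ray x e.
Proof. by case=> r ->; exists (- r); rewrite tropical_shiftK. Qed.

Lemma ray_shift r e x : ray e (tropical_shift r x) -> ray e x.
Proof.
case=> s rx; exists (s - r); rewrite -(tropical_shiftK r x) rx.
by apply/rowP => i; rewrite !mxE addeA -EFinD [(- r + s)%R]addrC.
Qed.

Lemma tropical_cone_shift C r x :
  tropical_cone T op C -> C x -> C (tropical_shift r x).
Proof.
move=> /[dup] Ccone [CT _ Cc] Cx.
have := Cc x x r%:E o Cx Cx (dioid_fin dioid r) (dioid_zero dioid).
congr (C _); apply/rowP => i; rewrite !mxE.
by rewrite [X in op _ X]addeC absorb ?op0//; exact: CT.
Qed.

(** By contraposition, combinations of vectors of [C] off the ray of [e] stay off it. *)
Definition irreducible C e : Prop :=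
  forall x y (l m : \bar R), C x -> C y -> T l -> T m ->
    ray e (\row_i op (l + x 0%R i)%E (m + y 0%R i)%E) -> ray e x \/ ray e y.

(** Otherwise [E] lies in [C] minus the ray of [e], a cone that misses [e]. The finite coordinate
    keeps the zero vector off the ray, so this cone is nonempty. *)
Lemma generates_meets_ray C E e :
  generates T op E C -> C e -> irreducible C e ->
  (exists i, e 0%R i \is a fin_num) -> exists2 x, E x & ray e x.
Proof.
move=> [Ccone EC Cmin] Ce irr [i0 ei0]; apply: contrapT => noE.
have [CT _ Cc] := Ccone.
suff /Cmin : tropical_cone T op (C `\` ray e).
  case/(_ _ _ Ce)=> [x Ex|_]; last by apply; exact: rayxx.
  by split; [exact: EC|move=> ex; apply: noE; exists x].
split.
- by move=> x [/CT].
- exists (const_mx o); split; first exact: tropical_cone_zero.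
  case=> r /rowP /(_ i0); rewrite !mxE => eo.
  by have := dioid_zero_nfin dioid; rewrite eo fin_numD ei0.
- move=> x y l m [Cx ex] [Cy ey] Tl Tm; split; first exact: Cc.
  by case/(irr _ _ _ _ Cx Cy Tl Tm).
Qed.

(** * Generating sets of irreducible vectors *)

Section IrreducibleGenerators.
Variables (C E : set 'rV[\bar R]_n.+1).
Hypothesis genE : generates T op E C.
Hypothesis irrE : forall e, E e ->
  irreducible C e /\ exists i, e 0%R i \is a fin_num.

(** A minimal generating set meets the ray of every [e] in [E]. Its members on these rays already
    generate [C], so by minimality it has no others. *)
Lemma extremal_in_ray g :
  extremal_generators T op C g -> exists2 e, E e & ray e g.
Proof.
case=> F [genF minF] Fg; have [Ccone EC Cmin] := genE.
pose F' := [set x | F x /\ exists2 e, E e & ray e x].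
suff /minF eqF : generates T op F' C.
  have: F' g by rewrite eqF// => x [].
  by case.
have [_ FC FCmin] := genF; split=> // [x [/FC //]|C' C'cone F'C'].
apply: Cmin => // e Ee; have [irre fin_e] := irrE Ee.
have [x Fx ex] := generates_meets_ray genF (EC _ Ee) irre fin_e.
have : C' x by apply: F'C'; split=> //; exists e.
by case: (ray_sym ex) => r ->; exact: tropical_cone_shift.
Qed.

(** A generating subset of [E] meets the ray of each [f] in [E], and [f] is the only element of [E]
    on that ray, so [E] is minimal. *)
Lemma extremal_generatorsT :
  (forall e f, E e -> E f -> ray e f -> f = e) ->
  E `<=` extremal_generators T op C.
Proof.
move=> inj e Ee; exists E => //; split=> // E' sE' gen'.
rewrite eqEsubset; split=> // f Ef; have [irrf finf] := irrE Ef.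
have [_ EC _] := genE.
have [x E'x fx] := generates_meets_ray gen' (EC _ Ef) irrf finf.
by rewrite -(inj f x)//; exact: sE'.
Qed.

End IrreducibleGenerators.

(** * Tropical unit vectors *)

Definition unit_vec (j : 'I_n.+1) : 'rV[\bar R]_n.+1 :=
  \row_i (if i == j then 0%E else o).

(** Induction on [s], adding [x_j] times the unit vector of [j]; repeated indices are absorbed by
    idempotence. *)
Lemma cone_unit_span C x (s : seq 'I_n.+1) :
  tropical_cone T op C -> vecs_in T x -> {in s, forall j, C (unit_vec j)} ->
  C (\row_i if i \in s then x 0%R i else o).
Proof.
move=> Ccone Tx; have [_ _ Cc] := Ccone.
elim: s => [|j s IH] Cs.
  have := tropical_cone_zero Ccone; congr (C _).
  by apply/rowP => i; rewrite !mxE.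
have Cj : C (unit_vec j) by apply: Cs; rewrite inE eqxx.
have {}IH := IH (fun k ks => Cs k (mem_behead (s := j :: s) ks)).
have := Cc _ _ _ _ Cj IH (Tx j) (dioid_fin dioid 0).
congr (C _); apply/rowP => i; rewrite !mxE inE add0e.
case: eqVneq => [->|_] /=; last by rewrite absorb // dioid_add0l.
by rewrite adde0; case: ifP => _; rewrite ?op0 ?dioid_idem.
Qed.

Lemma ray_unit_vec x j (l : \bar R) (r : R) : (l + x 0%R j)%E = r%:E ->
  (forall i, i != j -> (l + x 0%R i)%E = o) -> ray (unit_vec j) x.
Proof.
move=> lxj lxi; have : (l + x 0%R j)%E \is a fin_num by rewrite lxj.
rewrite fin_numD => /andP[/fineK lE _]; move: lxj lxi; rewrite -lE.
move: (fine l) => k lxj lxi; apply: (@ray_shift k); exists r.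
apply/rowP => i; rewrite !mxE; case: eqVneq => [->|/lxi ->].
  by rewrite lxj adde0.
by rewrite absorb //; exact: (dioid_fin dioid).
Qed.

(** One of the two terms attains the sum at [j]. Elsewhere the sum is [o], which forces both terms
    to be [o], so the attaining term is a multiple of the unit vector. *)
Lemma unit_vec_irreducible C j : irreducible C (unit_vec j).
Proof.
move=> x y l m _ _ _ _ [r /rowP xy].
have xyj : op (l + x 0%R j)%E (m + y 0%R j)%E = r%:E.
  by have := xy j; rewrite !mxE eqxx adde0.
have xyi i : i != j -> op (l + x 0%R i)%E (m + y 0%R i)%E = o.
  move=> /negbTE ij; have := xy i; rewrite !mxE ij absorb //.
  exact: (dioid_fin dioid).
case: (sel (l + x 0%R j)%E (m + y 0%R j)%E); rewrite xyj => /esym lm.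
  by left; apply: ray_unit_vec lm _ => i /xyi /dioid_add_eq0.
by right; apply: ray_unit_vec lm _ => i /xyi; rewrite opC => /dioid_add_eq0.
Qed.

(** * Unit vectors together with normalized extreme vectors *)

Section NormalizedGenerators.
Variables C V : set 'rV[\bar R]_n.+1.
Hypothesis Ccone : tropical_cone T op C.
Hypothesis VC : V `<=` C.
Hypothesis V0 : forall v, V v -> v 0%R ord0 = 0%E.
Hypothesis unitC : forall j, j != ord0 -> C (unit_vec j).
(** The order is encoded by [op]: [op a b = b] means [a <= b] for max and [b <= a] for min. So
    [Vmax] makes the vectors of [V] minimal for max and maximal for min. *)
Hypothesis below : forall x, C x -> exists2 v, V v &
  forall i, i != ord0 -> op (x 0%R ord0 + v 0%R i)%E (x 0%R i) = x 0%R i.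
Hypothesis Vmax : forall v x, V v -> C x -> x 0%R ord0 = 0%E ->
  (forall i, op (x 0%R i) (v 0%R i) = v 0%R i) -> x = v.

(** One of the two terms attains the sum at coordinate 0. Rescaled to be [0] there, it precedes [v]
    in the order of [op], hence equals [v] by [Vmax]. *)
Lemma normalized_irreducible v : V v -> irreducible C v.
Proof.
move=> Vv.
have aux x (u : 'I_n.+1 -> \bar R) (l : \bar R) (r : R) : C x ->
    (forall i, op (l + x 0%R i)%E (u i) = (r%:E + v 0%R i)%E) ->
    (l + x 0%R ord0)%E = r%:E -> ray v x.
  move=> Cx xu lx0; have : (l + x 0%R ord0)%E \is a fin_num by rewrite lx0.
  rewrite fin_numD => /andP[/fineK lE _]; move: lx0 xu; rewrite -lE.
  move: (fine l) => k kx0 xu.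
  apply: (@ray_shift (k - r)); suff -> : tropical_shift (k - r) x = v.
    exact: rayxx.
  have shE i : tropical_shift (k - r) x 0%R i =
      ((- r)%:E + (k%:E + x 0%R i))%E.
    by rewrite mxE addeA -EFinD [(- r + k)%R]addrC.
  have vE i : v 0%R i = ((- r)%:E + op (k%:E + x 0%R i) (u i))%E.
    by rewrite xu addeA -EFinD addNr add0e.
  apply: Vmax => //; first exact: tropical_cone_shift.
    by rewrite shE kx0 -EFinD addNr.
  by move=> i; rewrite shE vE (dioid_addD dioid) dioid_add_addl.
move=> x y l m Cx Cy _ _ [r /rowP xy].
have {}xy i : op (l + x 0%R i)%E (m + y 0%R i)%E = (r%:E + v 0%R i)%E.
  by have := xy i; rewrite !mxE.
have xy0 : op (l + x 0%R ord0)%E (m + y 0%R ord0)%E = r%:E.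
  by rewrite xy V0 // adde0.
case: (sel (l + x 0%R ord0)%E (m + y 0%R ord0)%E); rewrite xy0 => /esym lm.
  by left; apply: aux Cx xy lm.
right; apply: (aux _ (fun i => l + x 0%R i)%E _ _ Cy _ lm) => i.
by rewrite opC.
Qed.

Definition generator : set 'rV[\bar R]_n.+1 :=
  V `|` [set e | exists2 j, j != ord0 & e = unit_vec j].

Lemma generator_irreducible e : generator e ->
  irreducible C e /\ exists i, e 0%R i \is a fin_num.
Proof.
case=> [Ve|[j _ ->]]; split.
- exact: normalized_irreducible.
- by exists ord0; rewrite V0.
- exact: unit_vec_irreducible.
- by exists j; rewrite mxE eqxx.
Qed.

(** Each [x] is [x_0] times the [v] given by [below], plus its own coordinates off 0, which the unit
    vectors span. *)
Lemma generator_generates : generates T op generator C.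
Proof.
have [CT _ Cc] := Ccone.
split=> // [e [/VC//|[j /unitC j0 ->//]]|C' C'cone sC' x Cx].
have [v Vv vx] := below Cx.
have C'v : C' v by apply: sC'; left.
have [_ _ C'c] := C'cone.
have C'u j : j \in enum (predC1 (@ord0 n)) -> C' (unit_vec j).
  by rewrite mem_enum inE => j0; apply: sC'; right; exists j.
have := C'c _ _ _ _ C'v (cone_unit_span C'cone (CT _ Cx) C'u)
  (CT _ Cx ord0) (dioid_fin dioid 0).
congr (C' _); apply/rowP => i; rewrite !mxE add0e mem_enum inE.
by case: eqVneq => [->|i0] /=; [rewrite (V0 Vv) adde0 op0|exact: vx].
Qed.

Lemma generator_ray e f : generator e -> generator f -> ray e f -> f = e.
Proof.
have o0 (r : R) : (r%:E + o)%E <> 0%E.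
  rewrite absorb; last exact: (dioid_fin dioid).
  by move=> oE; have := dioid_zero_nfin dioid; rewrite oE.
suff r0 : forall (r : R), generator e -> generator f ->
    f = tropical_shift r e -> r = 0.
  move=> Ee Ef [r fE]; rewrite fE (r0 r) //; apply/rowP => i.
  by rewrite mxE add0e.
move=> r [Ve|[j j0 ->]] [Vf|[k k0 ->]] /rowP fE.
- by have := fE ord0; rewrite mxE !V0 // adde0 => -[].
- have := fE ord0; rewrite !mxE V0// eq_sym (negbTE k0) adde0 => oE.
  by have := dioid_zero_nfin dioid; rewrite oE.
- by have := fE ord0; rewrite !mxE V0// eq_sym (negbTE j0) => /esym /o0.
- have := fE k; rewrite !mxE eqxx; case: eqVneq => [_|_ /esym /o0 //].
  by rewrite adde0 => -[].
Qed.

(** The unit vectors drop out because their 0th coordinate is [o]. *)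
Lemma normalized_extremal : V = [set @normalize R n g | g in
  [set g | extremal_generators T op C g /\ ord0 \in supp g]].
Proof.
rewrite eqEsubset; split=> [v Vv|_ [g [extg suppg] <-]].
- exists v; last by apply/rowP => i; rewrite mxE V0 // sube0.
  split; last by rewrite inE V0.
  apply: (extremal_generatorsT generator_generates generator_irreducible).
    exact: generator_ray.
  by left.
- have [e [Ve|[j j0 ->]] [r gE]] :=
    extremal_in_ray generator_generates generator_irreducible extg.
    suff -> : normalize g = e by [].
    apply/rowP => i; rewrite gE !mxE V0 // adde0.
    by rewrite addeC addeA -EFinN -EFinD addNr add0e.
  move: suppg; rewrite inE gE !mxE eq_sym (negbTE j0) absorb.
    by rewrite (negbTE (dioid_zero_nfin dioid)).
  exact: (dioid_fin dioid).
Qed.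

End NormalizedGenerators.

End Tropical.

(** * Coordinates of homogenized points *)

Lemma homog0 (R : realType) (d : nat) (z : 'rV[R]_d) : homog z 0 ord0 = 0.
Proof.
have e : @ord0 d = lshift d (@ord0 0) by exact: val_inj.
by rewrite /homog e; apply: etrans (row_mxEl _ _ _ _) _; rewrite mxE.
Qed.

Lemma homogS (R : realType) (d : nat) (z : 'rV[R]_d) (j : 'I_d) :
  homog z 0 (lift ord0 j) = z 0 j.
Proof. by rewrite /homog -rshift1; apply: etrans (row_mxEr _ _ _ _) _. Qed.

Lemma to_erealE (R : realType) (n : nat) (x : 'rV[R]_n) i :
  to_ereal x 0 i = (x 0 i)%:E.
Proof. by rewrite mxE. Qed.

Lemma TmaxD (R : realType) (a b : \bar R) : Tmax a -> Tmax b -> Tmax (a + b)%E.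
Proof. by case: a b => [a||] [b||]. Qed.

Lemma TminD (R : realType) (a b : \bar R) : Tmin a -> Tmin b -> Tmin (a + b)%E.
Proof. by case: a b => [a||] [b||]. Qed.

Lemma nbhs_coord (T : topologicalType) (m n : nat) (x : 'M[T]_(m, n)) i j
  (A : set T) : nbhs (x i j) A -> nbhs x [set y : 'M[T]_(m, n) | A (y i j)].
Proof.
move=> xA; exists (fun i' j' => if (i' == i) && (j' == j) then A else setT).
  move=> i' j'; case: ifP => [/andP[/eqP -> /eqP ->] //|_]; exact: filterT.
by move=> y /(_ i j); rewrite !eqxx.
Qed.

(** * The max-tropical cone and its real part *)

Section Cones.
Variables (R : realType) (d : nat) (N : set 'rV[R]_d).
Let G := [set to_ereal (homog z) | z in N].

Lemma MbarP x : Mbar G x <-> vecs_in (@Tmax R) x /\ exists2 z, N z &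
  forall j, (x 0%R ord0 + (z 0 j)%:E <= x 0%R (lift ord0 j))%E.
Proof.
split=> [[_ [z Nz <-]] [Tx]|[Tx [z Nz zx]]].
  rewrite to_erealE homog0 sube0 => /bigmin_geP[_ zx]; split=> //.
  exists z => // j; have := zx (lift ord0 j); rewrite !inE to_erealE homogS.
  by rewrite leeBrDr //; apply; rewrite eq_sym neq_lift.
exists (to_ereal (homog z)); first by exists z.
split=> //; rewrite to_erealE homog0 sube0.
apply/bigmin_geP; split=> [|i /andP[_]].
  exact: leey.
case: (unliftP ord0 i) => [j ->|-> /eqP//] _.
by rewrite to_erealE homogS leeBrDr.
Qed.

Lemma MP (x : 'rV[R]_d.+1) : M G x <-> exists2 z, N z &
  forall j, x 0 ord0 + z 0 j <= x 0 (lift ord0 j).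
Proof.
rewrite /M /= MbarP; split=> [[_ [z Nz zx]]|[z Nz zx]].
  by exists z => // j; have := zx j; rewrite !to_erealE -EFinD lee_fin.
split; first by move=> i; rewrite to_erealE.
by exists z => // j; rewrite !to_erealE -EFinD lee_fin.
Qed.

(** The term attaining the maximum at coordinate 0 lends its point of [N] to the sum. *)
Lemma Mbar_cone : N !=set0 ->
  tropical_cone (@Tmax R) (fun s t => maxe s t) (Mbar G).
Proof.
move=> [z0 Nz0]; split; first by move=> x /MbarP[].
  exists (const_mx -oo%E); apply/MbarP; split; first by move=> i; rewrite mxE.
  by exists z0 => // j; rewrite !mxE.
move=> x y l m /MbarP[Tx [z Nz zx]] /MbarP[Ty [w Nw wy]] Tl Tm.
apply/MbarP; split=> [i|].
  by rewrite mxE maxEle; case: ifP => _; exact: TmaxD.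
case: (leP (l + x 0%R ord0)%E (m + y 0%R ord0)%E) => xy.
  exists w => // j; rewrite !mxE (max_idPr xy) -addeA le_max.
  by rewrite orbC leeD2l.
exists z => // j; rewrite !mxE (max_idPl (ltW xy)) -addeA le_max.
by rewrite leeD2l.
Qed.

(** * Inequalities for the closed complement *)

Hypothesis Nfin : finite_set N.

(** If every inequality failed at [z], reals [r_j] strictly between [x_0 + z_j] and [x_j] would
    define an open box around [x]. Passing through both closures, the box would contain a point
    outside [M], yet all its real points lie in [M]. *)
Lemma Wbar_sub x : Wbar G x -> forall z, N z ->
  exists j, (x 0%R (lift ord0 j) <= x 0%R ord0 + (z 0 j)%:E)%E.
Proof.
case=> Wx Tx z Nz; apply: contrapT => xz.
have {}xz j : (x 0%R ord0 + (z 0 j)%:E < x 0%R (lift ord0 j))%E.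
  by rewrite ltNge; apply/negP => zj; apply: xz; exists j.
have /fin_all_exists[r rx] : forall j, exists r : R,
    (x 0%R ord0 + (z 0 j)%:E < r%:E)%E /\ (r%:E < x 0%R (lift ord0 j))%E.
  move=> j; have := xz j; have := Tx ord0; have := Tx (lift ord0 j).
  case: (x 0%R ord0) => [t||] //; case: (x 0%R (lift ord0 j)) => [s||] // _ _.
    rewrite -EFinD lte_fin => ts; exists ((t + z 0 j + s) / 2).
    by rewrite !lte_fin !midf_lt.
  move=> _; exists (t + z 0 j + 1).
  by rewrite -EFinD lte_fin ltrDl ltr01 ltry.
pose B j := [set y : 'rV[\bar R]_d.+1 |
  (y 0%R ord0 < (r j - z 0 j)%:E)%E /\ ((r j)%:E < y 0%R (lift ord0 j))%E].
have [_ [[w Ww <-] Bw]] :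
    (@to_ereal R d.+1 @` W G) `&` [set y | forall j, B j y] !=set0.
  apply: Wx; apply: (@filter_forall _ _ B (nbhs x)) => j.
  have [rj1 rj2] := rx j.
  apply: filterI.
    apply: (nbhs_coord (A := [set t | t < (r j - z 0 j)%:E]%E)).
    by apply: open_ereal_lt'; rewrite EFinB lteBrDr.
  apply: (nbhs_coord (A := [set t | (r j)%:E < t]%E)).
  exact: open_ereal_gt'.
pose B' j := [set y : 'rV[R]_d.+1 |
  (y 0%R ord0 < r j - z 0 j)%R /\ (r j < y 0%R (lift ord0 j))%R].
have [v [Mv B'v]] : ~` M G `&` [set y | forall j, B' j y] !=set0.
  apply: Ww; apply: (@filter_forall _ _ B' (nbhs w)) => j.
  have := Bw j; rewrite /B /= !to_erealE !lte_fin => -[rj1 rj2].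
  apply: filterI.
    apply: (nbhs_coord (A := [set t | t < r j - z 0 j])).
    exact: lt_nbhsl.
  apply: (nbhs_coord (A := [set t | r j < t])).
  exact: lt_nbhsr.
apply: Mv; apply/MP; exists z => // j; have [v0 vj] := B'v j.
by apply/ltW/(lt_trans _ vj); rewrite -ltrBrDr.
Qed.

(* Finite approximations of [x] from outside [M]: the 0th coordinate is
   approached by [up c], the others by [low]; for large [c] the inequalities
   describing [Wbar] become strict. *)
Let up (c : R) (t : \bar R) (n : nat) : R :=
  if t is r%:E then r + n.+1%:R^-1 else n%:R + c.
Let low (t : \bar R) (n : nat) : R :=
  if t is r%:E then Num.min r n%:R else n%:R.

Lemma cvg_up c (t : \bar R) : Tmin t -> (up c t n)%:E @[n --> \oo] --> t.
Proof.
case: t => [r||] // _.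
  apply: cvg_EFin; first exact: nearW.
  rewrite -[X in _ --> X](addr0 r) /up /=.
  apply: cvgD; first exact: cvg_cst.
  exact: cvg_harmonic.
apply/cvgeryP; apply/cvgryPge => A; near=> n.
rewrite /up -lerBlDr; near: n; exact: nbhs_infty_ger.
Unshelve. all: by end_near. Qed.

Lemma cvg_low (t : \bar R) : Tmin t -> (low t n)%:E @[n --> \oo] --> t.
Proof.
case: t => [r||] // _.
  apply: cvg_near_cst; near=> n; rewrite /low; congr EFin.
  apply/min_idPl; near: n; exact: nbhs_infty_ger.
apply/cvgeryP; exact: cvgr_idn.
Unshelve. all: by end_near. Qed.

(** Such a [c] handles infinite [x_0], where [n < n + c + z_j] is required. *)
Lemma lower_bound : exists c : R, forall z j, N z -> 0 < c + z 0 j.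
Proof.
have /finite_seqP[s NE] := Nfin.
exists (1 + \big[Num.max/0]_(z <- s) \big[Num.max/0]_j - (z 0 j)) => z j.
rewrite NE /= => zs; rewrite -addrA ltr_wpDr ?ltr01 // -[z 0 j]opprK subr_ge0.
apply: (le_trans (le_bigmax _ (fun k => - z 0 k) j)).
exact: (@le_bigmax_seq _ _ _ s _ z xpredT
  (fun z : 'rV[R]_d => \big[Num.max/0]_j - (z 0 j))).
Qed.

Lemma WbarP x : Wbar G x <-> vecs_in (@Tmin R) x /\ forall z, N z ->
  exists j, (x 0%R (lift ord0 j) <= x 0%R ord0 + (z 0 j)%:E)%E.
Proof.
split=> [Wx|[Tx xz]]; first by split; [have [] := Wx|exact: Wbar_sub].
split=> // B [P xP PB]; have [c c0] := lower_bound.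
pose w n : 'rV[R]_d.+1 :=
  \row_i if i == ord0 then up c (x 0%R i) n else low (x 0%R i) n.
have : \forall n \near \oo, forall i, P ord0 i (w n 0%R i)%:E.
  apply: (@filter_forall _ _ (fun i n => P ord0 i (w n 0%R i)%:E) \oo) => i.
  have wx : (w n 0%R i)%:E @[n --> \oo] --> x 0%R i.
    rewrite /w; under eq_cvg do rewrite mxE.
    by case: eqP => _; [exact: cvg_up|exact: cvg_low].
  exact: wx (xP ord0 i).
case/filter_ex => n Pn; exists (to_ereal (w n)); split; last first.
  by apply: PB => k i; rewrite ord1 to_erealE.
exists (w n) => //; apply: subset_closure => /MP[z Nz zw].
have [j] := xz z Nz; have := zw j.
rewrite !mxE eqxx eq_sym (negbTE (neq_lift _ _)).
have := Tx ord0; have := Tx (lift ord0 j); have := c0 z j Nz.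
(* For finite [x_0] strictness comes from the summand [n.+1%:R^-1] of [up]; for infinite [x_0] it
   comes from [c], as [low] never exceeds [n]. *)
rewrite leNgt => czj; case: (x 0%R ord0) => [t||] //.
  case: (x 0%R (lift ord0 j)) => [s||] // _ _ /negP wn.
  rewrite -EFinD lee_fin => st; apply: wn.
  rewrite /low /up (le_lt_trans _ (_ : s < _)) ?ge_min ?lexx //.
  by apply: (le_lt_trans st); rewrite ltrD2r ltrDl invr_gt0.
move=> Tj _ /negP + _; apply; apply: (@le_lt_trans _ _ n%:R).
  by case: (x 0%R (lift ord0 j)) Tj => [s||] //= _; rewrite ge_min lexx orbT.
by rewrite /up -addrA ltrDl.
Qed.

(** * Extremal generators of the max-tropical cone *)

Hypothesis antichain : forall z w, N z -> N w ->
  (forall j, w 0 j <= z 0 j) -> w = z.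

Lemma Mbar_normalized_extremal : N !=set0 ->
  G = [set normalize g | g in
        [set g | max_extremal_generators (Mbar G) g /\ ord0 \in supp g]].
Proof.
move=> N0; apply: (normalized_extremal (max_dioid R) (Mbar_cone N0)).
- move=> _ [z Nz <-]; apply/MbarP; split; first by move=> i; rewrite mxE.
  by exists z => // j; rewrite !to_erealE homog0 homogS add0e.
- by move=> _ [z Nz <-]; rewrite to_erealE homog0.
- move=> j j0; have [z Nz] := N0; apply/MbarP; split.
    by move=> i; rewrite mxE; case: ifP.
  by exists z => // i; rewrite !mxE eq_sym (negbTE j0) leNye.
- move=> x /MbarP[Tx [z Nz zx]]; exists (to_ereal (homog z)); first by exists z.
  move=> i; case: (unliftP ord0 i) => [j ->|-> /eqP//] _.
  by rewrite to_erealE homogS; apply/max_idPr.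
- move=> _ x [z Nz <-] /MbarP[_ [w Nw wx]] x0 xz.
  have {}xz i : (x 0%R i <= (homog z 0%R i)%:E)%E.
    by apply/max_idPr; have := xz i; rewrite to_erealE.
  (* Off coordinate 0, [w <= x <= z], so the antichain property squeezes [x]. *)
  have wz : w = z.
    apply: antichain => // j; rewrite -lee_fin -[in X in (_ <= X)%E]homogS.
    by apply: le_trans (xz _); have := wx j; rewrite x0 add0e.
  apply/rowP => i; rewrite to_erealE; apply/eqP; rewrite eq_le xz /=.
  case: (unliftP ord0 i) => [j ->|->]; last by rewrite x0 homog0.
  by have := wx j; rewrite x0 add0e wz homogS.
Qed.

(** * Maximal points of the min-tropical cone *)

Hypothesis d_gt0 : (0 < d)%N.

(** The term attaining the minimum at coordinate 0 lends its index [j] to the sum. *)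
Lemma Wbar_cone :
  tropical_cone (@Tmin R) (fun s t => mine s t) (Wbar G).
Proof.
split; first by move=> x /WbarP[].
  exists (const_mx +oo%E); apply/WbarP; split; first by move=> i; rewrite mxE.
  by move=> z _; exists (Ordinal d_gt0); rewrite !mxE.
move=> x y l m /WbarP[Tx xz] /WbarP[Ty yz] Tl Tm.
apply/WbarP; split=> [i|z Nz].
  by rewrite mxE minEle; case: ifP => _; exact: TminD.
case: (leP (l + x 0%R ord0)%E (m + y 0%R ord0)%E) => xy.
  have [j xj] := xz z Nz; exists j; rewrite !mxE (min_idPl xy) -addeA ge_min.
  by rewrite leeD2l.
have [j yj] := yz z Nz; exists j.
by rewrite !mxE (min_idPr (ltW xy)) -addeA ge_min orbC leeD2l.
Qed.

Definition maximal_points : set 'rV[\bar R]_d.+1 :=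
  [set a | [/\ Wbar G a, a 0%R ord0 = 0%E &
    forall x, Wbar G x -> x 0%R ord0 = 0%E ->
      (forall i, (a 0%R i <= x 0%R i)%E) -> x = a]].

Section Assignments.
Variable s : seq 'rV[R]_d.
Hypothesis Ns : N = [set` s].

(* The largest [a] with [a_0 = 0] such that [a_(f z) <= z_(f z)] for every point
   [z], where [f] acts on the positions of the points in [s]. *)
Definition assignment_bound (f : {ffun 'I_(size s) -> 'I_d}) :
    'rV[\bar R]_d.+1 :=
  \row_i if unlift ord0 i is Some j then
    \big[mine/+oo%E]_(k | f k == j) (s`_k 0 j)%:E else 0%E.

Lemma assignment_bound0 f : assignment_bound f 0 ord0 = 0%E.
Proof. by rewrite mxE unlift_none. Qed.

Lemma assignment_boundS f j : assignment_bound f 0 (lift ord0 j) =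
  \big[mine/+oo%E]_(k | f k == j) (s`_k 0 j)%:E.
Proof. by rewrite mxE liftK. Qed.

Lemma nth_assignment (k : 'I_(size s)) : N s`_k.
Proof. by rewrite Ns /= mem_nth. Qed.

Lemma Wbar_assignment_bound f : Wbar G (assignment_bound f).
Proof.
apply/WbarP; split=> [i|z].
  case: (unliftP ord0 i) => [j ->|->]; last by rewrite assignment_bound0.
  rewrite assignment_boundS /Tmin /= -ltNye; apply/bigmin_gtP.
  by split=> [|k _]; rewrite ?ltNyr.
rewrite Ns /= => /(nthP 0)[k ks <-]; exists (f (Ordinal ks)).
rewrite assignment_boundS assignment_bound0 add0e.
by apply: (@bigmin_le_cond _ _ _ _ (Ordinal ks)).
Qed.

Lemma Wbar_le_assignment_bound x : Wbar G x -> x 0%R ord0 = 0%E ->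
  exists f, forall i, (x 0%R i <= assignment_bound f 0%R i)%E.
Proof.
move=> /WbarP[_ xz] x0.
have /fin_all_exists[f xf] (k : 'I_(size s)) := xz _ (nth_assignment k).
exists (finfun f) => i.
case: (unliftP ord0 i) => [j ->|->]; last by rewrite assignment_bound0 x0.
rewrite assignment_boundS; apply/bigmin_geP; split=> [|k]; first exact: leey.
by rewrite ffunE => /eqP <-; have := xf k; rewrite x0 add0e.
Qed.

Lemma maximal_point_ge f : exists2 a, maximal_points a &
  forall i, (assignment_bound f 0%R i <= a 0%R i)%E.
Proof.
pose le f g := [forall i,
  (assignment_bound f 0%R i <= assignment_bound g 0%R i)%E].
have le_tr : transitive le.
  move=> g h k /forallP gh /forallP hk; apply/forallP => i.
  exact: le_trans (gh i) (hk i).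
have le_refl g : le g g by apply/forallP => i.
(* Among the bounds above that of [f], one with the largest down-set is maximal. *)
have := @arg_maxnP _ f (le f) (fun g => #|[pred h | le h g]|) (le_refl f).
case=> g fg gmax; exists (assignment_bound g); last exact/forallP.
split; [exact: Wbar_assignment_bound|exact: assignment_bound0|].
(* Any such [x] lies between the bounds of [g] and of some [h]; equality of the down-sets puts [h]
   below [g] and closes the chain. *)
move=> x Wx x0 gx; have [h xh] := Wbar_le_assignment_bound Wx x0.
have gh : le g h by apply/forallP => i; exact: le_trans (gx i) (xh i).
have sub : [pred k | le k g] \subset [pred k | le k h].
  by apply/fintype.subsetP => k; rewrite !inE => /le_tr; exact.
have /gmax hg := le_tr _ _ _ fg gh.
have /(_ h) : [pred k | le k g] =i [pred k | le k h].
  by apply/subset_cardP => //; apply/eqP; rewrite eqn_leq subset_leq_card.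
rewrite !inE le_refl => /forallP {}hg.
apply/rowP => i; apply/eqP; rewrite eq_le gx andbT.
exact: le_trans (xh i) (hg i).
Qed.

End Assignments.

Lemma Wbar_normalized_extremal : maximal_points = [set normalize a | a in
  [set a | min_extremal_generators (Wbar G) a /\ ord0 \in supp a]].
Proof.
have /finite_seqP[s Ns] := Nfin.
apply: (normalized_extremal (min_dioid R) Wbar_cone).
- by move=> a [].
- by move=> a [].
- move=> j j0; apply/WbarP; split; first by move=> i; rewrite mxE; case: ifP.
  move=> z _; exists (Ordinal d_gt0).
  by rewrite !mxE [ord0 == _]eq_sym (negbTE j0) addye ?leey.
- move=> x Wx; have [Tx _] := (WbarP x).1 Wx.
  have [x0|] := boolP (x 0%R ord0 \is a fin_num).
    have x0E := fineK x0; move: x0E; move: (fine _) => r x0E.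
    pose y := tropical_shift (- r) x.
    have Wy : Wbar G y.
      exact: (tropical_cone_shift (min_dioid R) _ Wbar_cone).
    have y0 : y 0%R ord0 = 0%E by rewrite mxE -x0E -EFinD addNr.
    have [f yf] := Wbar_le_assignment_bound Ns Wy y0.
    have [a Va fa] := maximal_point_ge Ns f; exists a => // i _.
    apply/min_idPr; rewrite -x0E -leeBlDl // addeC.
    by have := le_trans (yf i) (fa i); rewrite mxE.
  (* For [x_0 = +oo] any maximal point serves, here one above a constant assignment. *)
  have [a Va _] := maximal_point_ge Ns [ffun => Ordinal d_gt0].
  rewrite fin_numE (Tx ord0) /= negbK => /eqP x0; exists a => // i _.
  have [/WbarP[Ta _] _ _] := Va.
  by rewrite x0 addye ?minye //; exact: Ta.
- move=> v x [Wv v0 vmax] Wx x0 xv; apply: vmax => // i.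
  by rewrite -(xv i) ge_min lexx.
Qed.

(** If [a_j <= z_j], then [x_j < a_j] keeps [x] from lying above [z]. Conversely, a point outside
    [M] is strictly below each [z] at some index; these indices form an assignment whose bound, and
    any maximal point above it, exceeds [x] strictly off coordinate 0. *)
Lemma orthants_maximal_points :
  \bigcup_(a in maximal_points) open_orthant a =
  ~` [set x : 'rV[R]_d | M G (homog x)].
Proof.
rewrite eqEsubset; split=> [x [a [/WbarP[Ta az] a0 _] xa]|x /= xM].
  move=> /= /MP[z Nz zx].
  have [j] := az z Nz; rewrite a0 add0e => aj.
  have aj_fin : lift ord0 j \in supp a.
    rewrite inE fin_numE; apply/andP; split; first exact: Ta.
    by rewrite -ltey (le_lt_trans aj) ?ltry.
  have := xa _ aj_fin; rewrite eq_sym neq_lift homogS => /(_ isT) xj.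
  have := lt_le_trans xj aj; rewrite lte_fin ltNge.
  by have := zx j; rewrite homog0 homogS add0r => ->.
have /finite_seqP[s Ns] := Nfin.
have /fin_all_exists[f xf] (k : 'I_(size s)) : exists j, x 0 j < s`_k 0 j.
  apply: contrapT => kx; apply: xM; apply/MP.
  exists s`_k; first exact: nth_assignment.
  move=> j; rewrite homog0 homogS add0r leNgt; apply/negP => xj.
  by apply: kx; exists j.
have [a Va fa] := maximal_point_ge Ns (finfun f); exists a => // i _.
case: (unliftP ord0 i) => [j ->|-> /eqP//] _; rewrite homogS.
apply: lt_le_trans (fa _); rewrite assignment_boundS; apply/bigmin_gtP.
by split=> [|k]; rewrite ?ltry // ffunE => /eqP <-; rewrite lte_fin.
Qed.

End Cones.

(** * Application to nondominated points *)

Lemma nondominated_antichain (R : realType) (d : nat) (Z : set 'rV[R]_d) z w :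
  nondominated Z z -> nondominated Z w -> (forall j, w 0 j <= z 0 j) -> w = z.
Proof.
move=> [_ zmin] [Zw _] wz; apply/rowP => j; apply/eqP.
rewrite eq_le wz leNgt; apply/negP => wj.
by apply: zmin; exists w; split=> //; exists j.
Qed.

Theorem corollary21 (R : realType) (d : nat) (hd : (1 <= d)%N)
    (Z N : set 'rV[R]_d) (hN : N = nondominated Z)
    (hfin : finite_set N) (hne : N !=set0) :
  let G := [set to_ereal (homog z) | z in N] in
  let A := [set normalize a | a in
              [set a | min_extremal_generators (Wbar G) a /\
                       ord0 \in supp a]] in
  G = [set normalize g | g in
         [set g | max_extremal_generators (Mbar G) g /\
                  forall i, i \in supp g]] /\
  \bigcup_(a in A) open_orthant a = ~` [set x : 'rV[R]_d | M G (homog x)].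
Proof.
move=> G A; split; last first.
  by rewrite /A -Wbar_normalized_extremal // orthants_maximal_points.
(* [Mbar_normalized_extremal] selects generators by coordinate 0 alone. A generator that normalizes
   to a vector of [G] has only finite coordinates, since that vector is real, so both selections
   agree. *)
have GE : G = _ := Mbar_normalized_extremal _ hne.
rewrite eqEsubset; split=> [g Gg|_ [g [extg fing] <-]].
  have := Gg; rewrite [X in X g -> _]GE; last first.
    by rewrite hN; exact: nondominated_antichain.
  case=> h [exth supph] hg; exists h => //; split=> // i.
  have [z _ zg] := Gg; have : g 0%R i \is a fin_num by rewrite -zg to_erealE.
  by rewrite -hg mxE fin_numD => /andP[].
rewrite GE; last by rewrite hN; exact: nondominated_antichain.
by exists g => //; split.
Qed.
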